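(* Let $m$ be an arbitrary positive integer and $q$ an odd prime power coprime to $m$. Let $\gamma$ be an element of $\mathbb{Z}/m\mathbb{Z}$ (represented by an integer, also denoted $\gamma$) with associated $q$-cyclotomic coset $c_{m/q}(\gamma)=\{\gamma,\gamma q,\dots,\gamma q^{\tau-1}\}$ modulo $m$, of size $\tau$. (1) If $2m\mid\gamma q^{\tau}-\gamma$, that is, $v_2(q^{\tau}-1)+v_2(\gamma)\ge v_2(m)+1$, then, viewing $\gamma$ as an element of $\mathbb{Z}/2m\mathbb{Z}$, the $q$-cyclotomic coset modulo $2m$ containing $\gamma$ is $c_{2m/q}(\gamma)=\{\gamma,\gamma q,\dots,\gamma q^{\tau-1}\}$ (of size $\tau$). Moreover, the $q$-cyclotomic coset $c_{2m/q}(m+\gamma)=\{m+\gamma,(m+\gamma)q,\dots,(m+\gamma)q^{\tau-1}\}$ modulo $2m$ containing $m+\gamma$ (of size $\tau$) is disjoint from $c_{2m/q}(\gamma)$, and the union $c_{2m/q}(\gamma)\sqcup c_{2m/q}(m+\gamma)$ is exactly the preimage of $c_{m/q}(\gamma)$ under the projection $\pi_{2m/m}$. (2) If $2m\nmid\gamma q^{\tau}-\gamma$, that is, $v_2(q^{\tau}-1)+v_2(\gamma)<v_2(m)+1$, then, viewing $\gamma$ as an element of $\mathbb{Z}/2m\mathbb{Z}$, the $q$-cyclotomic coset modulo $2m$ containing $\gamma$ is $c_{2m/q}(\gamma)=\{\gamma,\gamma q,\dots,\gamma q^{2\tau-1}\}$ (of size $2\tau$). Moreover, the coset $c_{2m/q}(\gamma)$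 contains $m+\gamma$, and is exactly the preimage of $c_{m/q}(\gamma)$ under $\pi_{2m/m}$.
   Context: For $N\ge1$ coprime to $q$ and $\gamma\in\mathbb{Z}/N\mathbb{Z}$, the $q$-cyclotomic coset modulo $N$ containing $\gamma$ is $c_{N/q}(\gamma)=\{\gamma,\gamma q,\dots,\gamma q^{\tau-1}\}\subseteq\mathbb{Z}/N\mathbb{Z}$, where $\tau$ is the smallest positive integer with $\gamma q^{\tau}=\gamma$ in $\mathbb{Z}/N\mathbb{Z}$. $\pi_{2m/m}:\mathbb{Z}/2m\mathbb{Z}\to\mathbb{Z}/m\mathbb{Z}$ is the canonical projection. $v_2$ is the $2$-adic valuation, with $v_2(0)=\infty$. *)

(* Defs.v *)
From mathcomp Require Import all_boot all_order all_algebra.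
From mathcomp Require Import cyclic constructive_ereal.

Set Implicit Arguments.
Unset Strict Implicit.
Unset Printing Implicit Defensive.

Import Order.TTheory GRing.Theory Num.Theory.
Local Open Scope ring_scope.

(* Z/NZ for N >= 1, including the trivial ring Z/1Z, which 'Z_N does not cover
   ('Z_1 is Z/2Z).  Only the additive structure is needed: multiplication by a
   natural number k is x *+ k.  The value at N = 0 is junk. *)
Definition Zmod (N : nat) : Type := 'I_N.-1.+1.

Definition Zmod_of_int (N : nat) (a : int) : Zmod N := (Zp1 : Zmod N) *~ a.

Definition Zmod_proj2 (m : nat) (x : Zmod (2 * m)) : Zmod m :=
  inZp (x : 'I_(2 * m).-1.+1).

Lemma Zmod_mulrn_val (N : nat) (x : Zmod N) (k : nat) :
  nat_of_ord (x *+ k) = ((x : 'I_N.-1.+1) * k %% N.-1.+1)%N.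
Proof. by rewrite (@Zp_mulrn N.-1 x k). Qed.

Lemma cyclotomic_period_ex (N q : nat) (x : Zmod N) :
  exists t : nat, (0 < t)%N && (coprime N q ==> (x *+ (q ^ t)%N == x)).
Proof.
exists (totient N.-1.+1); rewrite totient_gt0 /=.
apply/implyP => coNq; apply/eqP/val_inj; rewrite /= Zmod_mulrn_val.
have coq : coprime q N.-1.+1.
  by case: N x coNq => [|N] x; rewrite coprime_sym // coprimen1.
rewrite -modnMmr Euler_exp_totient // modnMmr muln1.
exact: (modn_small (ltn_ord (x : 'I_N.-1.+1))).
Qed.

(* The coprimality guard makes the definition total: the value is the smallest
   positive t with x q^t = x if N is coprime to q (see cyclotomic_periodP), and
   is junk otherwise. *)
Definition cyclotomic_period (N q : nat) (x : Zmod N) : nat :=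
  ex_minn (cyclotomic_period_ex q x).

Lemma cyclotomic_periodP (N q : nat) (x : Zmod N) : coprime N q ->
  [/\ (0 < cyclotomic_period q x)%N,
      x *+ (q ^ cyclotomic_period q x)%N = x
    & forall t : nat, (0 < t)%N -> x *+ (q ^ t)%N = x ->
        (cyclotomic_period q x <= t)%N].
Proof.
move=> coNq; rewrite /cyclotomic_period; case: ex_minnP => t.
rewrite coNq /= => /andP[t0 /eqP xt] tmin; split=> // s s0 xs.
by apply: tmin; rewrite s0 xs eqxx.
Qed.

Definition cyclotomic_coset (N q : nat) (x : Zmod N) : {set Zmod N} :=
  [set x *+ (q ^ (j : nat))%N | j : 'I_(cyclotomic_period q x)].

Lemma card_cyclotomic_coset (N q : nat) (x : Zmod N) : coprime N q ->
  #|cyclotomic_coset q x| = cyclotomic_period q x.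
Proof.
move=> coNq; have [_ xP xmin] := cyclotomic_periodP x coNq.
set P := cyclotomic_period q x in xP xmin *.
rewrite card_imset ?card_ord //.
suff inj (i j : 'I_P) : (i < j)%N -> x *+ (q ^ i)%N <> x *+ (q ^ j)%N.
  move=> i j eij; apply/val_inj; case: (ltngtP i j) => // lt_ij.
    by case: (inj _ _ lt_ij).
  by case: (inj _ _ lt_ij).
(* multiplying by q^(P - j) would give the smaller period P - j + i *)
move=> lt_ij eij; have jP := ltnW (ltn_ord j).
have : x *+ (q ^ (P - j + i))%N = x.
  by rewrite addnC expnD mulrnA eij -mulrnA -expnD subnKC.
move=> /xmin; rewrite addn_gt0 subn_gt0 ltn_ord => /(_ isT).
rewrite leqNgt => /negP[]; apply: (@leq_trans (P - j + j)%N); last by rewrite subnK.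
by rewrite ltn_add2l.
Qed.

(* 2-adic valuation of an integer, with v2 0 = +oo. *)
Definition v2 (a : int) : \bar int :=
  if a == 0 then +oo%E else ((logn 2 `|a|%N)%:Z)%:E.

(* Main.v *)
(* Write M for the class of m in Z/2mZ.  The fibres of Z/2mZ -> Z/mZ are the
   pairs {x, M + x}, and M q^j = M because q is odd.  Hence the preimage of the
   coset of gamma is always the union of the cosets of gamma and M + gamma, and
   gamma q^t lies in {gamma, M + gamma} modulo 2m iff tau divides t.  Everything
   then depends on whether gamma q^tau is gamma (two disjoint cosets of size
   tau) or M + gamma (one coset of size 2 tau). *)

Require Import Defs.
From mathcomp Require Import all_boot all_order all_algebra.
From mathcomp Require Import constructive_ereal.

Set Implicit Arguments.
Unset Strict Implicit.
Unset Printing Implicit Defensive.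

Import Order.TTheory GRing.Theory Num.Theory.
Local Open Scope ring_scope.

Lemma PoszX (n k : nat) : (n ^ k)%N%:Z = n%:Z ^+ k.
Proof. by rewrite -!natz natrX. Qed.

(** * Periods and cosets modulo a fixed [N] *)

Section CyclotomicPeriod.

Variables (N q : nat) (coNq : coprime N q).
Implicit Types x y : Zmod N.

Lemma mulrn_exp_period x t k : x *+ (q ^ t)%N = x -> x *+ (q ^ (t * k))%N = x.
Proof.
move=> xt; elim: k => [|k IHk]; first by rewrite muln0 expn0 mulr1n.
by rewrite mulnS expnD mulrnA xt.
Qed.

Lemma mulrn_exp_modn x j :
  x *+ (q ^ (j %% cyclotomic_period q x))%N = x *+ (q ^ j)%N.
Proof.
have [_ xP _] := cyclotomic_periodP x coNq.
by rewrite [in RHS](divn_eq j (cyclotomic_period q x)) expnD mulrnA mulnC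
           mulrn_exp_period.
Qed.

Lemma cyclotomic_period_dvd x t :
  (x *+ (q ^ t)%N == x) = (cyclotomic_period q x %| t)%N.
Proof.
have [P0 xP xmin] := cyclotomic_periodP x coNq.
apply/eqP/idP => [xt|/dvdnP[k ->]]; last by rewrite mulnC mulrn_exp_period.
(* A nonzero remainder of [t] modulo the period would be a smaller positive exponent fixing [x]. *)
rewrite /dvdn -leqn0 leqNgt; apply/negP => r0.
have := xmin _ r0; rewrite leqNgt ltn_mod P0 => /(_ _)/negP; apply => //.
by rewrite mulrn_exp_modn.
Qed.

(** Two numbers with the same multiples are equal. The periods modulo [2 * m] are computed this
    way. *)
Lemma cyclotomic_period_eq x P :
  (forall t, (x *+ (q ^ t)%N == x) = (P %| t)%N) -> cyclotomic_period q x = P.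
Proof.
move=> xP; apply/eqP.
by rewrite eqn_dvd -cyclotomic_period_dvd xP dvdnn -xP cyclotomic_period_dvd dvdnn.
Qed.

(** Reducing exponents modulo the period frees [j] from its bound. *)
Lemma cyclotomic_cosetP x y :
  reflect (exists j, y = x *+ (q ^ j)%N) (y \in cyclotomic_coset q x).
Proof.
apply: (iffP imsetP) => [[j _ ->]|[j ->]]; first by exists (j : nat).
have [P0 _ _] := cyclotomic_periodP x coNq.
by exists (Ordinal (ltn_pmod j P0)) => //=; rewrite mulrn_exp_modn.
Qed.

Lemma mem_cyclotomic_coset x j : x *+ (q ^ j)%N \in cyclotomic_coset q x.
Proof. by apply/cyclotomic_cosetP; exists j. Qed.

Lemma cyclotomic_coset_sym x y :
  (y \in cyclotomic_coset q x) = (x \in cyclotomic_coset q y).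
Proof.
suff imp (u v : Zmod N) : v \in cyclotomic_coset q u -> u \in cyclotomic_coset q v.
  by apply/idP/idP; apply: imp.
move=> /cyclotomic_cosetP[j ->]; apply/cyclotomic_cosetP.
have [P0 uP _] := cyclotomic_periodP u coNq.
(* This exponent completes [j] to a multiple of the period of [u]. *)
exists (cyclotomic_period q u * j - j)%N.
by rewrite -mulrnA -expnD subnKC ?leq_pmull // mulrn_exp_period.
Qed.

Lemma cyclotomic_coset_sub x y :
  y \in cyclotomic_coset q x -> cyclotomic_coset q y \subset cyclotomic_coset q x.
Proof.
move=> /cyclotomic_cosetP[j ->]; apply/subsetP => _ /cyclotomic_cosetP[k ->].
by rewrite -mulrnA -expnD mem_cyclotomic_coset.
Qed.

Lemma cyclotomic_coset_disjoint x y :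
  y \notin cyclotomic_coset q x ->
  [disjoint cyclotomic_coset q x & cyclotomic_coset q y].
Proof.
apply: contraR => /pred0Pn[z /andP[/= zx]].
by rewrite cyclotomic_coset_sym => /(subsetP (cyclotomic_coset_sub zx)).
Qed.

End CyclotomicPeriod.

(** * Residue classes of integers *)

Lemma Zmod_of_nat_val (N n : nat) : nat_of_ord (Zmod_of_int N n) = (n %% N.-1.+1)%N.
Proof.
rewrite /Zmod_of_int -pmulrn Zmod_mulrn_val /=.
by rewrite modnMml mul1n.
Qed.

Lemma Zmod_of_int_eq0 (N : nat) (a : int) : (0 < N)%N ->
  (Zmod_of_int N a == 0) = (N%:Z %| a)%Z.
Proof.
move=> N0; have natE (n : nat) : (Zmod_of_int N n == 0) = (N %| n)%N.
  by rewrite -val_eqE /= Zmod_of_nat_val prednK.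
case: a => n; first by rewrite natE.
by rewrite NegzE /Zmod_of_int mulrNz oppr_eq0 [LHS]natE dvdzE abszN.
Qed.

Lemma Zmod_of_int_mulrn (N : nat) (a : int) (k : nat) :
  Zmod_of_int N a *+ k = Zmod_of_int N (a * k).
Proof. by rewrite /Zmod_of_int pmulrn -mulrzA. Qed.

Lemma Zmod_of_intB (N : nat) (a b : int) :
  Zmod_of_int N (a - b) = Zmod_of_int N a - Zmod_of_int N b.
Proof. exact: mulrzBr. Qed.

Lemma Zmod_of_intD (N : nat) (a b : int) :
  Zmod_of_int N (a + b) = Zmod_of_int N a + Zmod_of_int N b.
Proof. exact: mulrzDr. Qed.

Lemma Zmod_of_intK (N : nat) (x : Zmod N) :
  Zmod_of_int N (nat_of_ord (x : 'I_N.-1.+1)) = x.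
Proof. by apply/val_inj; rewrite /= Zmod_of_nat_val modn_small. Qed.

(** * The projection from modulo [2 * m] to modulo [m] *)

Section Doubling.

Variables (m : nat) (m_gt0 : (0 < m)%N).
Implicit Types x y : Zmod (2 * m).

Let half : Zmod (2 * m) := Zmod_of_int (2 * m) m%:Z.

Lemma Zmod_half_neq0 : half != 0.
Proof.
rewrite Zmod_of_int_eq0 ?muln_gt0 //.
by apply/negP => /(dvdn_leq m_gt0); rewrite leqNgt ltn_Pmull.
Qed.

Lemma Zmod_halfD : half + half = 0.
Proof.
apply/eqP; rewrite -Zmod_of_intD Zmod_of_int_eq0 ?muln_gt0 //.
by rewrite -PoszD addnn -mul2n dvdzz.
Qed.

Lemma Zmod_half_mulrn_odd k : odd k -> half *+ k = half.
Proof.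
move=> ok; rewrite -(odd_double_half k) ok add1n mulrS -mul2n mulrnA.
by rewrite mulr2n Zmod_halfD mul0rn addr0.
Qed.

(** The projection acts on natural representatives, so [a] is first replaced by its remainder modulo
    [2 * m], which is nonnegative and congruent to [a] modulo both [2 * m] and [m]. *)
Lemma Zmod_proj2_of_int a :
  Zmod_proj2 (Zmod_of_int (2 * m) a) = Zmod_of_int m a.
Proof.
have natE (n : nat) : Zmod_proj2 (Zmod_of_int (2 * m) n) = Zmod_of_int m n.
  apply/val_inj; rewrite /= !Zmod_of_nat_val !prednK ?muln_gt0 //.
  by rewrite modn_dvdm ?dvdn_mull.
have m2_neq0 : (2 * m)%N%:Z != 0 by rewrite eqz_nat muln_eq0 -lt0n m_gt0.
have dvd_m : (m%:Z %| (2 * m)%N%:Z)%Z by rewrite PoszM dvdz_mull.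
have modE N : (0 < N)%N -> (N%:Z %| (2 * m)%N%:Z)%Z ->
    Zmod_of_int N a = Zmod_of_int N (a %% (2 * m)%N)%Z.
  move=> N0 dvd_N; apply/eqP; rewrite -subr_eq0 -Zmod_of_intB Zmod_of_int_eq0 //.
  by rewrite {1}(divz_eq a (2 * m)%N) addrK dvdz_mull.
rewrite (modE (2 * m)%N) ?muln_gt0 ?dvdzz // (modE m) //.
by rewrite -(gez0_abs (modz_ge0 a m2_neq0)) natE.
Qed.

Lemma Zmod_proj2_mulrn x k : Zmod_proj2 (x *+ k) = Zmod_proj2 x *+ k.
Proof.
by rewrite -(Zmod_of_intK x) Zmod_of_int_mulrn !Zmod_proj2_of_int Zmod_of_int_mulrn.
Qed.

(** For representatives with [a - b = c * m], the two alternatives on the right say that [c],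
    respectively [c - 1], is even. *)
Lemma Zmod_proj2_eq x y :
  (Zmod_proj2 x == Zmod_proj2 y) = (x == y) || (x == half + y).
Proof.
rewrite -(Zmod_of_intK x) -(Zmod_of_intK y) !Zmod_proj2_of_int.
move: (Posz _) (Posz _) => b a; rewrite -Zmod_of_intD.
rewrite -3![_ == Zmod_of_int _ _]subr_eq0 -!Zmod_of_intB.
rewrite !Zmod_of_int_eq0 ?muln_gt0 // opprD addrCA.
have m_neq0 : m%:Z != 0 by rewrite eqz_nat -lt0n.
apply/idP/orP => [/dvdzP[c Ec]|].
  have dvd2 d : ((2 * m)%N%:Z %| d * m%:Z)%Z = (2 %| d)%Z.
    by rewrite PoszM dvdz_mul2r // (negPf m_neq0).
  have -> : - m%:Z + (a - b) = (c - 1) * m%:Z by rewrite Ec mulrBl mul1r addrC.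
  rewrite Ec !dvd2 -eqz_mod_dvd.
  have [|c_odd] := boolP (2 %| c)%Z; [by left | right].
  have := modz_ge0 c (isT : 2%:Z != 0); have := ltz_pmod c (isT : 0 < 2%:Z).
  have : (c %% 2)%Z != 0 by apply: contraNneq c_odd => /dvdz_mod0P.
  (* The remainder is nonzero and lies in [[0, 2)], so it is 1. *)
  by case: (c %% 2)%Z => [[|[|n]]|n].
have dvd_m : (m%:Z %| (2 * m)%N%:Z)%Z by rewrite PoszM dvdz_mull.
by case=> /(dvdz_trans dvd_m) //; rewrite rpredDl ?rpredN /= ?dvdzz.
Qed.

End Doubling.

(** With [n = c * m], both sides say that [c] is even. *)
Lemma dvdn_double_logn (m n : nat) : (0 < n)%N -> (m %| n)%N ->
  (2 * m %| n)%N = (logn 2 m < logn 2 n)%N.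
Proof.
move=> n0 /dvdnP[c En]; move: n0; rewrite En muln_gt0 => /andP[c0 m0].
by rewrite dvdn_pmul2r // lognM // -[X in (X < _)%N]add0n ltn_add2r logn_gt0 mem_primes c0.
Qed.

Lemma dvdz_double_v2 (m : nat) (a b : int) : (0 < m)%N -> a != 0 ->
  (m%:Z %| a * b)%Z ->
  ((2 * m)%N%:Z %| a * b)%Z = (v2 m%:Z + 1%:E <= v2 a + v2 b)%E.
Proof.
move=> m0 a0 dvd_m; rewrite /v2 (negPf a0) eqz_nat -[m == 0%N]leqn0 leqNgt m0 /=.
(* For [b = 0] both sides hold: the product is 0 and [v2 b] is infinite. *)
have [->|b0] := eqVneq b 0; first by rewrite mulr0 dvdz0 addey // leey.
rewrite -!EFinD lee_fin dvdzE abszM dvdn_double_logn ?muln_gt0 ?absz_gt0 ?a0 //.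
  by rewrite lognM ?absz_gt0 // -!PoszD lez_nat addn1.
by move: dvd_m; rewrite dvdzE abszM.
Qed.

Theorem lemma3p1 (m q : nat) (gamma : int)
    (m_gt0 : (0 < m)%N)
    (q_odd : odd q)
    (q_primepower : exists p k : nat, [/\ prime p, (0 < k)%N & q = (p ^ k)%N])
    (coprime_mq : coprime m q) :
  let g := Zmod_of_int m gamma in
  let g2 := Zmod_of_int (2 * m) gamma in
  let mg2 := Zmod_of_int (2 * m) (m%:Z + gamma) in
  let tau := cyclotomic_period q g in
  let preimage := @Zmod_proj2 m @^-1: cyclotomic_coset q g in
  let divides := ((2 * m)%N%:Z %| gamma * q%:Z ^+ tau - gamma)%Z in
  (* (1) *)
  ((divides <-> (v2 (q%:Z ^+ tau - 1) + v2 gamma >= v2 m%:Z + 1%:E)%E) /\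
   (divides ->
    [/\ cyclotomic_coset q g2 = [set g2 *+ (q ^ (j : nat))%N | j : 'I_tau] /\
          #|cyclotomic_coset q g2| = tau,
        cyclotomic_coset q mg2 = [set mg2 *+ (q ^ (j : nat))%N | j : 'I_tau] /\
          #|cyclotomic_coset q mg2| = tau,
        [disjoint cyclotomic_coset q g2 & cyclotomic_coset q mg2]
      & cyclotomic_coset q g2 :|: cyclotomic_coset q mg2 = preimage]))
  /\
  (* (2) *)
  ((~~ divides <-> (v2 (q%:Z ^+ tau - 1) + v2 gamma < v2 m%:Z + 1%:E)%E) /\
   (~~ divides ->
    [/\ cyclotomic_coset q g2 =
          [set g2 *+ (q ^ (j : nat))%N | j : 'I_(2 * tau)] /\
          #|cyclotomic_coset q g2| = (2 * tau)%N,
        mg2 \in cyclotomic_coset q g2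
      & cyclotomic_coset q g2 = preimage])).
Proof.
move=> g g2 mg2 tau preimage divides.
have m2_gt0 : (0 < 2 * m)%N by rewrite muln_gt0.
have co2 : coprime (2 * m) q by rewrite coprimeMl coprime_mq coprime2n q_odd.
have [tau_gt0 gtau _] := cyclotomic_periodP g coprime_mq; rewrite -/tau in tau_gt0 gtau.
set half := Zmod_of_int (2 * m) m%:Z.
have proj_g2 : Zmod_proj2 g2 = g by exact: Zmod_proj2_of_int.
have mg2E : mg2 = half + g2 by exact: Zmod_of_intD.
have half_expn j : half *+ (q ^ j)%N = half.
  by rewrite Zmod_half_mulrn_odd // oddX q_odd orbT.
have half_neq0 : half != 0 by exact: Zmod_half_neq0.
have mg2_expn j : mg2 *+ (q ^ j)%N = half + g2 *+ (q ^ j)%N.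
  by rewrite mg2E mulrnDl half_expn.
have g_fix t : (g2 *+ (q ^ t)%N == g2) || (g2 *+ (q ^ t)%N == mg2) = (tau %| t)%N.
  by rewrite mg2E -Zmod_proj2_eq // Zmod_proj2_mulrn // proj_g2 cyclotomic_period_dvd.
have dividesE : divides = (g2 *+ (q ^ tau)%N == g2).
  rewrite -subr_eq0 Zmod_of_int_mulrn -Zmod_of_intB Zmod_of_int_eq0 //.
  by rewrite /divides -PoszX.
have union : cyclotomic_coset q g2 :|: cyclotomic_coset q mg2 = preimage.
  apply/setP => x; rewrite !inE; apply/orP/cyclotomic_cosetP => //.
    case=> /cyclotomic_cosetP[] // j ->; exists j.
      by rewrite Zmod_proj2_mulrn // proj_g2.
    apply/eqP; rewrite -proj_g2 -Zmod_proj2_mulrn // Zmod_proj2_eq //.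
    by rewrite mg2_expn eqxx orbT.
  case=> j /eqP; rewrite -proj_g2 -Zmod_proj2_mulrn // Zmod_proj2_eq // -mg2_expn.
  by case/orP => /eqP ->; [left|right]; apply: mem_cyclotomic_coset.
have valuation : divides = (v2 m%:Z + 1%:E <= v2 (q%:Z ^+ tau - 1) + v2 gamma)%E.
  have dividesM : gamma * q%:Z ^+ tau - gamma = (q%:Z ^+ tau - 1) * gamma.
    by rewrite mulrBl mul1r mulrC.
  rewrite /divides dividesM dvdz_double_v2 //.
    (* [q ^ tau - 1] is nonzero, as [q ^ tau] is a prime raised to the positive exponent
       [k * tau]. *)
    have [p [k [p_prime k_gt0 ->]]] := q_primepower.
    rewrite subr_eq0 -PoszX -expnM eqz_nat.
    by rewrite -(expn0 p) eqn_exp2l ?prime_gt1 // muln_eq0 negb_or -!lt0n k_gt0.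
  rewrite -dividesM -Zmod_of_int_eq0 // Zmod_of_intB subr_eq0.
  by rewrite -PoszX -Zmod_of_int_mulrn; apply/eqP.
split; split.
- by rewrite valuation.
- rewrite dividesE => /eqP g2tau.
  have g2_notin : mg2 \notin cyclotomic_coset q g2.
    (* If [mg2 = g2 * q ^ j], then [tau] divides [j] by [g_fix]; as [q ^ tau] fixes [g2], this gives
       [mg2 = g2], hence [half = 0]. *)
    apply/(cyclotomic_cosetP co2) => -[j mg2j].
    have := g_fix j; rewrite -mg2j eqxx orbT => /esym/dvdnP[k Ej].
    move: mg2j; rewrite Ej [(k * _)%N]mulnC mulrn_exp_period // mg2E -[RHS]add0r.
    by move/addIr/eqP; rewrite (negPf half_neq0).
  have g2P : cyclotomic_period q g2 = tau.
    apply: cyclotomic_period_eq => // t; rewrite -g_fix.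
    (* The second alternative of [g_fix] would put [mg2] in the coset of [g2]. *)
    case: eqP => //= _; apply/esym; apply: contraNF g2_notin => /eqP <-.
    exact: mem_cyclotomic_coset.
  have mg2P : cyclotomic_period q mg2 = tau.
    apply: cyclotomic_period_eq => // t.
    (* Translation by [half] commutes with multiplication by [q ^ t], so [mg2] and [g2] are fixed by
       the same exponents. *)
    by rewrite mg2_expn mg2E (inj_eq (addrI _)) cyclotomic_period_dvd // g2P.
  split=> //; last exact: cyclotomic_coset_disjoint.
    by rewrite card_cyclotomic_coset // g2P /cyclotomic_coset g2P.
  by rewrite card_cyclotomic_coset // mg2P /cyclotomic_coset mg2P.
- by rewrite valuation ltNge.
- rewrite dividesE => g2tau.
  have {}g2tau : g2 *+ (q ^ tau)%N = mg2.
    by have := g_fix tau; rewrite (negPf g2tau) dvdnn => /eqP.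
  have mg2_in : mg2 \in cyclotomic_coset q g2.
    by rewrite -g2tau mem_cyclotomic_coset.
  (* Each multiplication by [q ^ tau] adds [half], and twice [half] is 0. *)
  have g2_fix2 : g2 *+ (q ^ (tau * 2))%N = g2.
    rewrite muln2 -addnn expnD mulrnA g2tau mg2_expn g2tau mg2E addrA.
    by rewrite Zmod_halfD // add0r.
  have g2P : cyclotomic_period q g2 = (2 * tau)%N.
    apply: cyclotomic_period_eq => // t; apply/idP/idP => [g2t|]; last first.
      by case/dvdnP=> k ->; rewrite [(k * _)%N]mulnC [(2 * tau)%N]mulnC mulrn_exp_period.
    (* Here [t = k * tau]. For odd [k], removing the multiples of [2 * tau] leaves
       [g2 * q ^ tau = mg2], which differs from [g2]. *)
    have := g_fix t; rewrite g2t => /esym/dvdnP[k Et].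
    rewrite Et dvdn_pmul2r // dvdn2; apply: contraL g2t => k_odd.
    have -> : t = (tau * 2 * k./2 + tau)%N.
      by rewrite Et -{1}(odd_double_half k) k_odd -mul2n mulnDl mul1n addnC [(_ * tau)%N]mulnC mulnA.
    rewrite expnD mulrnA mulrn_exp_period // g2tau mg2E.
    by rewrite -subr_eq0 addrK.
  split=> //; first by rewrite card_cyclotomic_coset // g2P /cyclotomic_coset g2P.
  (* The coset of [mg2] lies in that of [g2], so the union collapses. *)
  by rewrite -union; apply/esym/setUidPl/cyclotomic_coset_sub.
Qed.
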